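(* Let $G=(V,E)$ be a flower with center hyperedge $e_0$ and petals $e_1,\ldots,e_m$ (so $E=\{e_0,e_1,\ldots,e_m\}$, $m\ge1$, and $e_j\cap e_0\neq\emptyset$ for all $j\in\{1,\ldots,m\}$). Assume the petals are pairwise disjoint outside the center, i.e. $(e_j\setminus e_0)\cap(e_k\setminus e_0)=\emptyset$ for all $1\le j<k\le m$, and that their intersections with the center are pairwise disjoint, i.e. $(e_j\cap e_0)\cap(e_k\cap e_0)=\emptyset$ for all $1\le j<k\le m$. Then $\operatorname{VAW}(G)\le 4$.
   Context: A hypergraph $G=(V,E)$ has finite vertex set $V$ and a set $E$ of hyperedges $e\subseteq V$ with $|e|\ge2$. A flower consists of a center hyperedge $e_0$ and a nonempty set of other hyperedges, called petals, each of which meets the center and whose intersections with the center are pairwise disjoint. Valid-antichain width. For a vertex order $\sigma=(v_1,\ldots,v_n)$ of $V$ ($n=|V|$) and $i\in\{0,\ldots,n\}$, let $U_0=\emptyset$, $U_i=\{v_1,\ldots,v_i\}$, $\mathcal{A}_i=\{e\in E:e\cap U_i\ne\emptyset,\ e\nsubseteq U_i\}$ (active hyperedges), $\rho_i(e)=e\cap U_i$ for $e\in\mathcal{A}_i$, and $\mathcal{R}_i=\{\rho_i(e):e\in\mathcal{A}_i\}$, partially ordered by inclusion. An antichain $\mathcal{C}\subseteq\mathcal{R}_i$ is a (possibly empty) set of pairwise incomparable elements; with $X(\mathcal{C})=\bigcup_{R\in\mathcal{C}}R$, it is valid if for every $R\in\mathcal{R}_i$ with $R\subseteq X(\mathcal{C})$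 there exists $M\in\mathcal{C}$ with $R\subseteq M$. Let $\operatorname{VA}_i(\sigma)$ be the set of valid antichains of $(\mathcal{R}_i,\subseteq)$, $W(\sigma)=\max_i|\operatorname{VA}_i(\sigma)|$, and $\operatorname{VAW}(G)=\min_\sigma W(\sigma)$, the minimum over all vertex orders. *)

(* Defs.v *)
From HB Require Import structures.
From mathcomp Require Import all_boot.

Set Implicit Arguments.
Unset Strict Implicit.
Unset Printing Implicit Defensive.

(* The vertex set V is the whole finite type T; isolated vertices are allowed. *)
Record hypergraph (T : finType) := Hypergraph {
  hedges : {set {set T}};
  hedges_card : forall e, e \in hedges -> 2 <= #|e|
}.

Definition is_flower (T : finType) (G : hypergraph T)
    (e0 : {set T}) (P : {set {set T}}) : Prop :=
  [/\ e0 \in hedges G,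
      P != set0,
      P \subset hedges G :\ e0,
      forall p, p \in P -> p :&: e0 != set0
    & forall p q, p \in P -> q \in P -> p != q ->
        [disjoint p :&: e0 & q :&: e0]].

(* A duplicate-free tuple of length #|T| lists every vertex exactly once. *)
Definition vertex_order (T : finType) := {s : #|T|.-tuple T | uniq s}.

Definition enum_order (T : finType) : vertex_order T :=
  exist (fun s : #|T|.-tuple T => uniq s) (enum_tuple T) (enum_uniq T).

Section ValidAntichainWidth.

Variables (T : finType) (G : hypergraph T).
Implicit Types (s : vertex_order T) (i : nat) (C : {set {set T}}).

Definition prefix_set s i : {set T} := [set x in take i (val s)].

Definition active s i : {set {set T}} :=
  [set e in hedges G |
    (e :&: prefix_set s i != set0) && ~~ (e \subset prefix_set s i)].

Definition traces s i : {set {set T}} :=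
  [set e :&: prefix_set s i | e in active s i].

Definition antichain C : bool :=
  [forall A in C, forall B in C, (A != B) ==> ~~ (A \subset B)].

Definition valid_in (R C : {set {set T}}) : bool :=
  [forall A in R, (A \subset cover C) ==> [exists M in C, A \subset M]].

Definition valid_antichains s i : {set {set {set T}}} :=
  [set C : {set {set T}} |
    [&& C \subset traces s i, antichain C & valid_in (traces s i) C]].

Definition order_width s : nat :=
  \max_(i < #|T|.+1) #|valid_antichains s i|.

(* [enum_order T] only witnesses that the minimum is over a nonempty set. *)
Definition VAW : nat :=
  order_width [arg min_(s < enum_order T) order_width s].

End ValidAntichainWidth.

(* Main.v *)
Require Import Defs.
From HB Require Import structures.
From mathcomp Require Import all_boot.

Set Implicit Arguments.
Unset Strict Implicit.
Unset Printing Implicit Defensive.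

(** A valid antichain is in particular a set of traces, so [k] active hyperedges
    leave at most [2 ^ k] valid antichains; it is enough to find a vertex order
    under which at most two hyperedges are active at any time. Together the two
    disjointness hypotheses make the petals pairwise disjoint, inside and
    outside the center. List the vertices petal by petal, and then those lying
    in no petal. Each petal is exhausted before the next one is entered
    ([sorted_prefix_leq]), so at most one petal is active at a time
    ([petal_active_inj]), and the only other hyperedge that can be active is
    the center. Hence the width of this order is at most [2 ^ 2 = 4]. *)

Lemma VAW_leq_order_width (T : finType) (G : hypergraph T)
  (s : vertex_order T) : VAW G <= order_width G s.
Proof. by rewrite /VAW; case: arg_minnP => // s0 _; apply. Qed.

(** Distinct traces come from distinct active hyperedges, so there are at most
    [k] traces, and every valid antichain is one of the at most [2 ^ k] sets of
    traces. *)
Lemma order_width_leq_exp (T : finType) (G : hypergraph T)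
    (s : vertex_order T) (k : nat) :
  (forall i, #|active G s i| <= k) -> order_width G s <= 2 ^ k.
Proof.
move=> active_le; apply/bigmax_leqP => i _.
have antichains_sub : valid_antichains G s i \subset powerset (traces G s i).
  by apply/subsetP => C; rewrite !inE => /and3P[].
apply: leq_trans (subset_leq_card antichains_sub) _.
rewrite card_powerset leq_exp2l //.
exact: leq_trans (leq_imset_card _ _) (active_le i).
Qed.

Section SortedOrder.

Variables (T : finType) (key : T -> nat).

Let key_leq : rel T := relpre key leq.

Lemma sorted_order_subproof :
  size (sort key_leq (enum T)) == #|T|.
Proof. by rewrite size_sort -cardE. Qed.

Lemma sorted_order_uniq : uniq (Tuple sorted_order_subproof).
Proof. by rewrite sort_uniq enum_uniq. Qed.

Definition sorted_order : vertex_order T :=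
  exist (fun s : #|T|.-tuple T => uniq s) _ sorted_order_uniq.

Lemma sorted_prefix_leq i u v :
  u \in prefix_set sorted_order i -> v \notin prefix_set sorted_order i ->
  key u <= key v.
Proof.
rewrite !inE /= => u_take v_take.
have key_leq_trans : transitive key_leq by move=> y x z; apply: leq_trans.
have : pairwise key_leq (sort key_leq (enum T)).
  rewrite -(sorted_pairwise key_leq_trans).
  by apply: sort_sorted => x y; apply: leq_total.
have : v \in sort key_leq (enum T) by rewrite mem_sort mem_enum.
rewrite -{1 2}(cat_take_drop i (sort key_leq (enum T))).
rewrite mem_cat (negbTE v_take) pairwise_cat /= => v_drop /andP[/allrelP h _].
exact: h.
Qed.

End SortedOrder.

Section PetalOrder.

Variables (T : finType) (m : nat) (e : 'I_m -> {set T}).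
Hypothesis e_disj : forall j k, j != k -> [disjoint e j & e k].

(** The default value [m] exceeds every index, which puts the vertices lying in
    no petal last. *)
Definition petal_index (v : T) : nat :=
  if [pick j | v \in e j] is Some j then val j else m.

Lemma petal_indexE j v : v \in e j -> petal_index v = j.
Proof.
move=> vj; rewrite /petal_index; case: pickP => [k vk | /(_ j)]; last by rewrite vj.
by have [-> // | /e_disj/disjointFr/(_ vk)] := eqVneq k j; rewrite vj.
Qed.

(** An active petal has a listed and an unlisted vertex. With two active
    petals, comparing the listed vertex of each with the unlisted vertex of the
    other gives both inequalities between their indices. *)
Lemma petal_active_inj (G : hypergraph T) i j k :
  e j \in active G (sorted_order petal_index) i ->
  e k \in active G (sorted_order petal_index) i -> j = k.
Proof.
have active_leq a b : e a \in active G (sorted_order petal_index) i ->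
    e b \in active G (sorted_order petal_index) i -> a <= b.
  rewrite !in_set => /and3P[_ /set0Pn[u /setIP[ua u_listed]] _].
  move=> /and3P[_ _ /subsetPn[v vb v_unlisted]].
  rewrite -(petal_indexE ua) -(petal_indexE vb).
  exact: sorted_prefix_leq u_listed v_unlisted.
by move=> ja ka; apply/val_inj/eqP; rewrite eqn_leq !active_leq.
Qed.

Lemma card_active_petal_order (G : hypergraph T) (e0 : {set T}) i :
  hedges G = e0 |: [set e j | j : 'I_m] ->
  #|active G (sorted_order petal_index) i| <= 2.
Proof.
move=> G_edges; set A := active _ _ _.
rewrite (cardsD1 e0); apply: (@leq_add _ _ 1 1); first exact: leq_b1.
have petalP f : f \in A :\ e0 -> exists2 j, f = e j & e j \in A.
  case/setD1P=> f_neq0 fA; have: f \in hedges G by move: fA; rewrite inE => /andP[].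
  rewrite G_edges in_setU1 (negbTE f_neq0) => /imsetP[j _ def_f].
  by exists j; rewrite -?def_f.
apply/card_le1_eqP => f g /petalP[j -> jA] /petalP[k -> kA].
by rewrite (petal_active_inj jA kA).
Qed.

End PetalOrder.

Lemma disjoint_split (T : finType) (A B C : {set T}) :
  [disjoint A :&: C & B :&: C] -> [disjoint A :\: C & B :\: C] ->
  [disjoint A & B].
Proof.
rewrite -!setI_eq0 -setIIl -setDIl => /eqP insideE /eqP outsideE.
by rewrite -(setID (A :&: B) C) insideE outsideE setU0.
Qed.

Theorem proposition1 (T : finType) (G : hypergraph T) (m : nat)
    (e0 : {set T}) (e : 'I_m -> {set T})
    (m_ge1 : 1 <= m)
    (G_flower : is_flower G e0 [set e j | j : 'I_m])
    (G_edges : hedges G = e0 |: [set e j | j : 'I_m])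
    (meet_center : forall j : 'I_m, e j :&: e0 != set0)
    (disj_outside : forall j k : 'I_m, j < k ->
       [disjoint e j :\: e0 & e k :\: e0])
    (disj_inside : forall j k : 'I_m, j < k ->
       [disjoint e j :&: e0 & e k :&: e0]) :
  VAW G <= 4.
Proof.
have e_disj j k : j != k -> [disjoint e j & e k].
  wlog lt_jk : j k / j < k => [hwlog neq_jk|_].
    have [/hwlog|/hwlog|/val_inj/eqP] := ltngtP j k; first exact.
      by rewrite disjoint_sym eq_sym; apply.
    by rewrite (negbTE neq_jk).
  exact: disjoint_split (disj_inside _ _ lt_jk) (disj_outside _ _ lt_jk).
apply: leq_trans (VAW_leq_order_width G (sorted_order (petal_index e))) _.
apply: (@order_width_leq_exp _ _ _ 2) => i.
exact: (card_active_petal_order e_disj i G_edges).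
Qed.
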